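(* Let $X$, $Y$ be two smooth manifolds and $c\in C^1(X\times Y)$. Let $(s\in[0,1])\mapsto\mathrm x(s)$ be a smooth curve in $X$ and let $\bar y\in Y$ be such that for all $s\in[0,1]$, $$\forall y\in Y,\quad c(\mathrm x(s),\bar y)-c(\mathrm x(s),y)\le(1-s)[c(\mathrm x(0),\bar y)-c(\mathrm x(0),y)]+s[c(\mathrm x(1),\bar y)-c(\mathrm x(1),y)].$$ Then, for all $s\in[0,1]$, $\nabla_yc(\mathrm x(s),\bar y)=(1-s)\nabla_yc(\mathrm x(0),\bar y)+s\nabla_yc(\mathrm x(1),\bar y)$.
   Context: $\nabla_yc(x,y)\in T_y^*Y$ denotes the differential of $c$ with respect to its second variable. The function $c$ is real-valued. *)

(* Defs.v *)
From HB Require Import structures.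
From mathcomp Require Import all_boot all_order all_algebra.
From mathcomp Require Import all_classical all_reals all_analysis.
Set Implicit Arguments.
Unset Strict Implicit.
Unset Printing Implicit Defensive.
Import Order.TTheory GRing.Theory Num.Theory.
Import numFieldNormedType.Exports.
Local Open Scope classical_set_scope.
Local Open Scope ring_scope.

(* f is of class C^k on U; only meant for U open.  All directional
   derivatives are required to be C^k, which in finite dimension amounts to
   the Frechet differential being C^k. *)
Fixpoint Ck {R : realType} {V W : normedModType R} (k : nat) (U : set V)
    (f : V -> W) : Prop :=
  match k with
  | 0%N => forall x, U x -> {for x, continuous f}
  | k'.+1 => (forall x, U x -> differentiable f x) /\
             (forall v : V, Ck k' U (fun x => 'D_v f x))
  end.

Definition Cinfty {R : realType} {V W : normedModType R} (U : set V)
  (f : V -> W) : Prop := forall k, Ck k U f.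

Record chart (R : realType) (n : nat) (M : topologicalType) := Chart {
  chart_dom : set M;
  chart_fun :> M -> 'rV[R]_n;
  chart_inv : 'rV[R]_n -> M;
  chart_dom_open : open chart_dom;
  chart_cod_open : open (chart_fun @` chart_dom);
  chart_funK : forall p, chart_dom p -> chart_inv (chart_fun p) = p;
  chart_fun_continuous :
    forall p, chart_dom p -> {for p, continuous chart_fun};
  chart_inv_continuous :
    forall u, (chart_fun @` chart_dom) u -> {for u, continuous chart_inv} }.

Definition chart_cod (R : realType) (n : nat) (M : topologicalType)
  (phi : chart R n M) : set 'rV[R]_n := phi @` chart_dom phi.

(* The atlas need not be maximal: it determines the smooth structure. *)
Record manifold (R : realType) (n : nat) := Manifold {
  manifold_space :> topologicalType;
  manifold_hausdorff : hausdorff_space manifold_space;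
  manifold_second_countable : @second_countable manifold_space;
  atlas : set (chart R n manifold_space);
  atlas_cover :
    forall p, exists phi, atlas phi /\ chart_dom phi p;
  atlas_compatible : forall phi psi, atlas phi -> atlas psi ->
    Cinfty (phi @` (chart_dom phi `&` chart_dom psi)) (psi \o chart_inv phi) }.

(* A curve is smooth on a set A of parameters which is not assumed open if it
   agrees locally with a smooth curve defined on an open set of parameters. *)
Definition smooth_curve_on (R : realType) (n : nat) (M : manifold R n)
    (A : set R) (x : R -> M) : Prop :=
  forall s, A s -> exists (U : set R) (g : R -> M),
    [/\ open U, U s,
        forall t, U t -> A t -> g t = x t,
        forall t, U t -> {for t, continuous g} &
        forall phi : chart R n M, atlas phi ->
          Cinfty (U `&` g @^-1` chart_dom phi) (phi \o g)].

(* The products of charts of X and Y form an atlas of X * Y. *)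
Definition C1_prod (R : realType) (m n : nat) (X : manifold R m)
    (Y : manifold R n) (c : X * Y -> R) : Prop :=
  forall (phi : chart R m X) (psi : chart R n Y), atlas phi -> atlas psi ->
    Ck 1 (chart_cod phi `*` chart_cod psi)
      (fun p : 'rV[R]_m * 'rV[R]_n =>
         c (chart_inv phi p.1, chart_inv psi p.2)).

Lemma diff_near_comp (R : realType) (U V W : normedModType R) (h : U -> V)
    (g : V -> W) (k : U -> W) (x u : U) (y : V) :
  h x = y -> differentiable h x -> differentiable g y -> differentiable k x ->
  (\near x, k x = g (h x)) -> 'd k x u = 'd g y ('d h x u).
Proof.
move=> <- dh dg dk kE.
transitivity ('d (g \o h) x u); last first.
  exact: (congr1 (fun F => F u) (diff_comp dh dg)).
rewrite -(deriveE _ dk) -(deriveE _ (differentiable_comp dh dg)).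
exact: near_eq_derive.
Qed.

Section TangentSpaces.
Context {R : realType} {n : nat} (M : manifold R n) (p : M).

Definition chart_around := {phi : chart R n M | atlas phi /\ chart_dom phi p}.

(* A tangent vector is given by its coordinates in each chart around p,
   transforming according to the differentials of the transition maps. *)
Definition tangent_pred : pred (chart_around -> 'rV[R]_n) :=
  fun v => `[< forall phi psi : chart_around,
    v psi = 'd (projT1 psi \o chart_inv (projT1 phi)) (projT1 phi p) (v phi) >].

Fact tangent_submod_closed : submod_closed tangent_pred.
Proof.
split=> [|a u v /asboolP uP /asboolP vP].
  by apply/asboolP => phi psi /=; rewrite linear0.
by apply/asboolP => phi psi /=; rewrite linearP -uP -vP.
Qed.
HB.instance Definition _ :=
  GRing.isSubmodClosed.Build R _ tangent_pred tangent_submod_closed.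

Record tangent := Tangent {
  tangent_coord :> chart_around -> 'rV[R]_n;
  _ : tangent_coord \in tangent_pred }.
HB.instance Definition _ := [isSub for tangent_coord].
HB.instance Definition _ := [Choice of tangent by <:].
HB.instance Definition _ := [SubChoice_isSubLmodule of tangent by <:].

Definition cotangent_pred : pred (tangent -> R) :=
  fun w => `[< forall (a : R) (u v : tangent), w (a *: u + v) = a * w u + w v >].

Fact cotangent_submod_closed : submod_closed cotangent_pred.
Proof.
split=> [|a f g /asboolP fP /asboolP gP].
  by apply/asboolP => b u v; rewrite /= mulr0 addr0.
apply/asboolP => b u v.
have E w : (a *: f + g) w = a * f w + g w by [].
by rewrite !E fP gP !mulrDr !mulrA (mulrC a b) addrACA.
Qed.
HB.instance Definition _ :=
  GRing.isSubmodClosed.Build R _ cotangent_pred cotangent_submod_closed.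

Record cotangent := Cotangent {
  cotangent_fun :> tangent -> R;
  _ : cotangent_fun \in cotangent_pred }.
HB.instance Definition _ := [isSub for cotangent_fun].
HB.instance Definition _ := [Choice of cotangent by <:].
HB.instance Definition _ := [SubChoice_isSubLmodule of cotangent by <:].

Definition some_chart : chart_around := cid (atlas_cover p).

Definition mdiff_fun (f : M -> R) (v : tangent) : R :=
  'd (f \o chart_inv (projT1 some_chart)) (projT1 some_chart p) (v some_chart).

Fact mdiff_fun_linear (f : M -> R) : mdiff_fun f \in cotangent_pred.
Proof. by apply/asboolP => a u v; rewrite /mdiff_fun /= linearP. Qed.

Definition mdiff (f : M -> R) : cotangent := Cotangent (mdiff_fun_linear f).

Lemma transition_differentiable (phi psi : chart_around) :
  differentiable (projT1 psi \o chart_inv (projT1 phi)) (projT1 phi p).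
Proof.
case: phi psi => [phi [aphi dphi]] [psi [apsi dpsi]] /=.
by have [+ _] := atlas_compatible aphi apsi 1; apply; exists p.
Qed.

Lemma diff_transition (V : normedModType R) (f : M -> V)
    (phi psi : chart_around) :
  differentiable (f \o chart_inv (projT1 psi)) (projT1 psi p) ->
  differentiable (f \o chart_inv (projT1 phi)) (projT1 phi p) ->
  forall u, 'd (f \o chart_inv (projT1 phi)) (projT1 phi p) u =
    'd (f \o chart_inv (projT1 psi)) (projT1 psi p)
      ('d (projT1 psi \o chart_inv (projT1 phi)) (projT1 phi p) u).
Proof.
move=> dfpsi dfphi u; have dt := transition_differentiable phi psi.
have [_ dphi] := projT2 phi; have [_ dpsi] := projT2 psi.
have pK := chart_funK dphi.
have hE : (projT1 psi \o chart_inv (projT1 phi)) (projT1 phi p) = projT1 psi p.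
  by rewrite /comp pK.
apply: (diff_near_comp u hE dt dfpsi dfphi).
have cphi := @chart_inv_continuous _ _ _ (projT1 phi) (projT1 phi p)
  (ex_intro2 _ _ p dphi erefl).
have dn : nbhs (chart_inv (projT1 phi) (projT1 phi p)) (chart_dom (projT1 psi)).
  by rewrite pK; apply: open_nbhs_nbhs; split => //; exact: chart_dom_open.
have H := cphi _ dn.
apply: (filterS (F := nbhs (projT1 phi p)) _ H) => q qd.
by rewrite /comp chart_funK.
Qed.

(* The coordinates in one chart identify the tangent space with R^n. *)
Lemma tangent_coord_bij (phi : chart_around) (u : 'rV[R]_n) :
  exists! v : tangent, v phi = u.
Proof.
pose v (psi : chart_around) :=
  'd (projT1 psi \o chart_inv (projT1 phi)) (projT1 phi p) u.
have vP : v \in tangent_pred.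
  apply/asboolP => a b; rewrite /v.
  exact: (diff_transition (transition_differentiable a b)
                          (transition_differentiable phi b)).
have diag (w : tangent) psi :
    w psi = 'd (projT1 psi \o chart_inv (projT1 phi)) (projT1 phi p) (w phi).
  by case: w => w /= /asboolP; apply.
exists (Tangent vP); split=> [|w wu]; last first.
  by apply/val_inj/funext => psi; rewrite [RHS]diag wu.
rewrite /= /v -deriveE; last exact: transition_differentiable.
rewrite (@near_eq_derive _ _ _ _ id) ?derive_id//.
have [_ dphi] := projT2 phi.
have : nbhs (projT1 phi p) (projT1 phi @` chart_dom (projT1 phi)).
  by apply: open_nbhs_nbhs; split; [exact: chart_cod_open|exists p].
by apply: filterS => _ /= [q qd <-]; rewrite chart_funK.
Qed.

(* mdiff f does not depend on some_chart. *)
Lemma mdiffE (f : M -> R) (phi : chart_around) (v : tangent) :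
  (forall psi : chart_around,
    differentiable (f \o chart_inv (projT1 psi)) (projT1 psi p)) ->
  mdiff f v = 'd (f \o chart_inv (projT1 phi)) (projT1 phi p) (v phi).
Proof.
move=> df; have E := diff_transition (df phi) (df some_chart).
rewrite [LHS]E; congr ('d _ _ _).
by case: v => v /= /asboolP vP; rewrite -vP.
Qed.

End TangentSpaces.

Definition nabla_y (R : realType) (m n : nat) (X : manifold R m)
    (Y : manifold R n) (c : X * Y -> R) (x : X) (y : Y) : cotangent y :=
  mdiff y (fun y' => c (x, y')).

(* Main.v *)
Require Import Defs.
From mathcomp Require Import all_boot all_order all_algebra.
From mathcomp Require Import all_classical all_reals all_analysis.
From mathcomp Require Import lra.
Import numFieldNormedType.Exports.
Local Open Scope classical_set_scope.
Local Open Scope ring_scope.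

Import Order.TTheory GRing.Theory Num.Theory.

(** The inequality at [s] says that the function
[[
    h y = c (x s, y) - (1 - s) * c (x 0, y) - s * c (x 1, y)
]]
attains its minimum over [Y] at [ybar].  Since [c] is C^1, [h] is
differentiable at [ybar], so its differential vanishes there (Fermat's rule,
[diff_at_local_min]); by linearity of the differential this is the claimed
identity.

The differential on [Y] is read in one chart around [ybar].  The
differentiability of [c] in its second variable ([partial_differentiable])
is obtained by freezing the first coordinate in a product of charts. *)

(** For [h > 0] the difference quotient has the sign of
[f (h *: v + a) - f a >= 0]; the two-sided limit defining the derivative is
therefore replaced by the right-hand one. *)
Lemma derive_ge0_local_min {R : realType} {V : normedModType R} (f : V -> R)
    (a v : V) :
  derivable f a v ->
  (\forall q \near a, f a <= f q) -> 0 <= 'D_v f a.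
Proof.
move=> dfa fmin; rewrite /derive cvg_at_rightE//.
apply: limr_ge.
  rewrite -(cvg_at_rightE (fun h : R => h^-1 *: ((f \o shift a) _ - f a)))//.
  apply: cvg_trans dfa; apply: cvg_app.
  move=> A [e egt0 Ae]; exists e => // t te tgt0; apply: Ae => //.
  exact/lt0r_neq0.
have line : (fun h : R => h *: v + a) @ at_right 0 --> a.
  rewrite -[X in _ --> X]add0r -[X in _ --> X + _](scale0r v).
  apply: cvg_at_right_filter; apply: cvgD; last exact: cvg_cst.
  by apply: cvgZr_tmp; exact: cvg_id.
near=> h; apply: mulr_ge0.
  by rewrite invr_ge0 ltW.
rewrite subr_ge0 /=; near: h; exact: line _ fmin.
Unshelve. all: by end_near. Qed.

(** Fermat's rule: the derivatives along [v] and [- v] are both nonnegative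
and are opposite to each other. *)
Lemma diff_at_local_min {R : realType} {V : normedModType R} (f : V -> R)
    (a v : V) :
  differentiable f a -> (\forall q \near a, f a <= f q) -> 'd f a v = 0.
Proof.
move=> dfa fmin.
have ge0 w : 0 <= 'd f a w.
  by rewrite -deriveE//; apply: derive_ge0_local_min => //;
    exact: diff_derivable.
by apply/eqP; rewrite eq_le ge0 andbT -oppr_ge0 -linearN ge0.
Qed.

Lemma partial_differentiable {R : realType} {m n : nat} {X : manifold R m}
    {Y : manifold R n} {c : X * Y -> R} (hc : C1_prod c) (x : X) (y : Y)
    (psi : chart_around y) :
  differentiable ((fun y' => c (x, y')) \o chart_inv (projT1 psi))
    (projT1 psi y).
Proof.
case: psi => psi [apsi dpsi] /=.
have [phi [aphi dphi]] := atlas_cover x.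
have [dc _] := hc _ _ aphi apsi.
have {}dc := dc (phi x, psi y) (conj (ex_intro2 _ _ x dphi erefl)
                                    (ex_intro2 _ _ y dpsi erefl)).
have dslice : differentiable (fun q : 'rV[R]_n => (phi x, q)) (psi y).
  exact: (@differentiable_pair _ _ _ _ (cst (phi x)) id).
have := differentiable_comp dslice dc; congr (differentiable _ _).
by apply/funext => q; rewrite /= chart_funK.
Qed.

Theorem lemma2p5 (R : realType) (m n : nat) (X : manifold R m)
    (Y : manifold R n) (c : X * Y -> R) (hc : C1_prod c)
    (x : R -> X) (hx : smooth_curve_on `[0, 1] x) (ybar : Y)
    (hcvx : forall s : R, 0 <= s <= 1 -> forall y : Y,
      c (x s, ybar) - c (x s, y) <=
        (1 - s) * (c (x 0, ybar) - c (x 0, y))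
        + s * (c (x 1, ybar) - c (x 1, y))) :
  forall s : R, 0 <= s <= 1 ->
    nabla_y c (x s) ybar =
      (1 - s) *: nabla_y c (x 0) ybar + s *: nabla_y c (x 1) ybar.
Proof.
move=> s s01; apply/val_inj/funext => v.
set psi := some_chart ybar.
pose f t := (fun y => c (x t, y)) \o chart_inv (projT1 psi).
set q0 := projT1 psi ybar; set w : 'rV[R]_n := v psi.
have df t : differentiable (f t) q0 by exact: partial_differentiable.
(* Equality of covectors, tested on [v] in the chart that defines [mdiff]. *)
change ('d (f s) q0 w = (1 - s) * 'd (f 0) q0 w + s * 'd (f 1) q0 w).
have dcomb : differentiable ((1 - s) *: f 0 + s *: f 1) q0.
  by apply: differentiableD; exact: differentiableZ.
have q0K : chart_inv (projT1 psi) q0 = ybar.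
  by apply: chart_funK; have [] := projT2 psi.
have gmin q : (f s \- ((1 - s) *: f 0 + s *: f 1)) q0 <=
              (f s \- ((1 - s) *: f 0 + s *: f 1)) q.
  have := hcvx s s01 (chart_inv (projT1 psi) q).
  by rewrite /f /= !fctE /GRing.scale/= q0K; lra.
have := diff_at_local_min _ _ w (differentiableB (df s) dcomb).
move=> /(_ (@filterE _ (nbhs q0) _ _ gmin)).
rewrite diffB//= diffD; try exact: differentiableZ.
by rewrite /= !diffZ// => /eqP; rewrite subr_eq0 => /eqP.
Qed.
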